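(* Let $n\in\mathbb N$ and $z:=\circ^m$ with $m\ge1$. Then, as compact quantum groups, $O_n^{z}$ is isomorphic to $O_n$ if $m$ is odd, and to $PO_n$ if $m$ is even.
   Context: $O_n$ is the classical orthogonal group, viewed as the compact matrix quantum group $(C(O_n),u)$, where $u=(u^i_j)_{1\le i,j\le n}$ are the coordinate functions and $\Delta(u^i_j)=\sum_k u^i_k\otimes u^k_j$ is the comultiplication $C(O_n)\to C(O_n)\otimes C(O_n)$. For $z=\circ^m$ (the word of $m$ letters $\circ$), $O_n^z=(A,u^{z})$, where $u^z$ is the $m$-fold tensor power of $u$, with entries $u^{i_1}_{j_1}\cdots u^{i_m}_{j_m}$, and $A\subseteq C(O_n)$ is the $C^*$-subalgebra generated by these entries, with the restricted comultiplication. The projective version $PO_n$ is the compact matrix quantum group given by the $C^*$-subalgebra of $C(O_n)$ generated by the entries $u^{i_1}_{j_1}(u^{i_2}_{j_2})^*$ of $u\otimes\overline u$, with the restricted comultiplication (classically $PO_n=O_n/(O_n\cap\{\lambda I:\lambda\in\mathbb C\})$). Compact matrix quantum groups $G$, $H$ are isomorphic as compact quantum groups if there is a unital $*$-isomorphism $\varphi:C(G)\to C(H)$ with $(\varphi\otimes\varphi)\circ\Delta_G=\Delta_H\circ\varphi$. *)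

(* Defs.v *)
From HB Require Import structures.
From mathcomp Require Import all_boot all_order all_algebra.
From mathcomp Require Import all_classical all_reals all_analysis.
From mathcomp Require Import complex.

Set Implicit Arguments.
Unset Strict Implicit.
Unset Printing Implicit Defensive.

Import Order.TTheory GRing.Theory Num.Theory.
Import numFieldNormedType.Exports.

Local Open Scope classical_set_scope.
Local Open Scope ring_scope.
Local Open Scope complex_scope.

(* Commutative unital C*-algebras are realised as algebras of functions on a
   compact space X.  On C(X) the topology of [{uniform X -> R[i]}] is that of
   the sup norm. *)
Section FunctionAlgebras.
Variable R : realType.
Implicit Types X Y : topologicalType.

Record cstar_subalgebra X (A : set (X -> R[i])) : Prop := CstarSubalgebra {
  cstar_continuous : forall f, A f -> continuous (f : X -> R[i]^o);
  cstar_one : A (fun=> 1);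
  cstar_add : forall f g, A f -> A g -> A (fun x => f x + g x);
  cstar_scale : forall (c : R[i]) f, A f -> A (fun x => c * f x);
  cstar_mul : forall f g, A f -> A g -> A (fun x => f x * g x);
  cstar_star : forall f, A f -> A (fun x => (f x)^*%C);
  cstar_closed : closed (A : set {uniform X -> R[i]^o}) }.

Definition cstar_gen X (S : set (X -> R[i])) : set (X -> R[i]) :=
  smallest (@cstar_subalgebra X) S.

Definition tensor X Y (f : X -> R[i]) (g : Y -> R[i]) : X * Y -> R[i] :=
  fun p => f p.1 * g p.2.

(* The C*-tensor product of A in C(X) and B in C(Y), inside C(X * Y); it is
   unambiguous because commutative C*-algebras are nuclear. *)
Definition tensor_alg X Y (A : set (X -> R[i])) (B : set (Y -> R[i])) :
    set (X * Y -> R[i]) :=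
  cstar_gen [set h | exists2 f, A f & exists2 g, B g & h = tensor f g].

(* phi is only meaningful on A. *)
Record star_hom X Y (A : set (X -> R[i])) (B : set (Y -> R[i]))
    (phi : (X -> R[i]) -> (Y -> R[i])) : Prop := StarHom {
  hom_sub : forall f, A f -> B (phi f);
  hom_one : phi (fun=> 1) = (fun=> 1);
  hom_add : forall f g, A f -> A g ->
    phi (fun x => f x + g x) = (fun y => phi f y + phi g y);
  hom_scale : forall (c : R[i]) f, A f ->
    phi (fun x => c * f x) = (fun y => c * phi f y);
  hom_mul : forall f g, A f -> A g ->
    phi (fun x => f x * g x) = (fun y => phi f y * phi g y);
  hom_star : forall f, A f ->
    phi (fun x => (f x)^*%C) = (fun y => (phi f y)^*%C) }.

Definition star_iso X Y (A : set (X -> R[i])) (B : set (Y -> R[i]))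
    (phi : (X -> R[i]) -> (Y -> R[i])) : Prop :=
  star_hom A B phi /\ set_bij A B phi.

(* Phi is phi (x) psi on A (x) A'.  These equations determine Phi there, since
   *-homomorphisms of C*-algebras are contractive. *)
Definition tensor_map X X' Y Y' (A : set (X -> R[i])) (A' : set (X' -> R[i]))
    (B : set (Y -> R[i])) (B' : set (Y' -> R[i]))
    (phi : (X -> R[i]) -> (Y -> R[i])) (psi : (X' -> R[i]) -> (Y' -> R[i]))
    (Phi : (X * X' -> R[i]) -> (Y * Y' -> R[i])) : Prop :=
  star_hom (tensor_alg A A') (tensor_alg B B') Phi /\
  forall f g, A f -> A' g -> Phi (tensor f g) = tensor (phi f) (psi g).

End FunctionAlgebras.

Section QuantumGroups.
Variable R : realType.

(* A commutative compact matrix quantum group (A, u) with A in C(base) and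
   comultiplication [comul] restricted to A.  Only the data is recorded;
   that [comul] maps A to A (x) A is required in [cqg_isomorphic]. *)
Record cmqg := Cmqg {
  base : topologicalType;
  funalg : set (base -> R[i]);
  comul : (base -> R[i]) -> (base * base -> R[i]);
  fund_index : finType;
  fund : fund_index -> fund_index -> base -> R[i] }.

Definition comul_into (G : cmqg) : Prop :=
  forall f, @funalg G f -> tensor_alg (@funalg G) (@funalg G) (@comul G f).

Definition cqg_isomorphic (G H : cmqg) : Prop :=
  [/\ comul_into G, comul_into H &
    exists phi Phi,
      [/\ star_iso (@funalg G) (@funalg H) phi,
          tensor_map (@funalg G) (@funalg G) (@funalg H) (@funalg H)
                     phi phi Phi &
          forall f, @funalg G f -> Phi (@comul G f) = @comul H (phi f)]].

End QuantumGroups.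

Section Orthogonal.
Variables (R : realType) (n : nat).

Definition orth_group : set 'M[R]_n := [set x | x *m x^T = 1%:M].

Lemma orth_group_mul (x y : orth_group) :
  set_val x *m set_val y \in orth_group.
Proof.
apply/mem_set; have := set_valP x; have := set_valP y.
rewrite /orth_group /= => yy xx.
by rewrite trmx_mul mulmxA -(mulmxA (set_val x)) yy mulmx1.
Qed.

Definition omul (x y : orth_group) : orth_group :=
  exist _ (set_val x *m set_val y) (orth_group_mul x y).

Definition ocoord (i j : 'I_n) (x : orth_group) : R[i] := (set_val x i j)%:C.

Definition odelta (f : orth_group -> R[i]) : orth_group * orth_group -> R[i] :=
  fun p => f (omul p.1 p.2).

(* The letters of words z: u^white = u and u^black is its conjugate. *)
Inductive letter := white | black.

Definition letter_coord (a : letter) (i j : 'I_n) (x : orth_group) : R[i] :=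
  match a with white => ocoord i j x | black => (ocoord i j x)^*%C end.

Definition word_coord (z : seq letter) (i j : (size z).-tuple 'I_n)
    (x : orth_group) : R[i] :=
  \prod_(k < size z) letter_coord (tnth (in_tuple z) k) (tnth i k) (tnth j k) x.

Definition proj_coord (i j : 'I_n * 'I_n) (x : orth_group) : R[i] :=
  ocoord i.1 j.1 x * (ocoord i.2 j.2 x)^*%C.

Definition entries (I : finType) (v : I -> I -> orth_group -> R[i]) :
    set (orth_group -> R[i]) :=
  [set f | exists i j, f = v i j].

Definition O_cmqg : cmqg R :=
  @Cmqg R orth_group [set f | continuous (f : orth_group -> R[i]^o)]
        odelta 'I_n ocoord.

Definition O_word_cmqg (z : seq letter) : cmqg R :=
  @Cmqg R orth_group (cstar_gen (entries (@word_coord z)))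
        odelta ((size z).-tuple 'I_n) (@word_coord z).

Definition PO_cmqg : cmqg R :=
  @Cmqg R orth_group (cstar_gen (entries proj_coord))
        odelta ('I_n * 'I_n)%type proj_coord.

End Orthogonal.

Arguments orth_group : clear implicits.

(* Main.v *)
Require Import Defs.
From mathcomp Require Import all_boot all_order all_algebra.
From mathcomp Require Import all_classical all_reals all_analysis.
From mathcomp Require Import complex ring lra.

(* All algebras involved are subalgebras of C(O_n), and the isomorphisms are
   equalities.  The entries of the m-fold power of u are the monomials of
   degree m in the coordinates; since the rows of an orthogonal matrix have
   norm 1, a monomial of degree d > 0 is a sum of monomials of degree d + 2, so
   the monomials of degree m generate the same algebra as those of degree 1
   (m odd) or 2 (m even).  Degree 1 gives C(O_n) by the Stone-Weierstrass
   theorem, degree 2 gives C(PO_n) because the coordinates are real. *)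

Set Implicit Arguments.
Unset Strict Implicit.
Unset Printing Implicit Defensive.

Import Order.TTheory GRing.Theory Num.Theory.
Import numFieldNormedType.Exports.

Local Open Scope classical_set_scope.
Local Open Scope ring_scope.

(** * Compactness as a local-to-global principle *)

(* The complements of the sets satisfying Q form a filter without cluster
   point, so this filter is improper. *)
Lemma compact_locally (T : topologicalType) (Q : set (set T)) :
  compact [set: T] -> Q set0 -> (forall U V, U `<=` V -> Q V -> Q U) ->
  (forall U V, Q U -> Q V -> Q (U `|` V)) ->
  (forall x : T, exists2 U : set T, nbhs x U & Q U) -> Q [set: T].
Proof.
move=> cT Q0 Qsub QU Qloc; apply: contrapT => QT.
pose F : set_system T := [set V | Q (~` V)].
have FF : ProperFilter F.
  apply: Build_ProperFilter_ex.
    move=> V QV; apply: contrapT => /forallNP V0; apply: QT.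
    by apply: Qsub QV => x _ /V0.
  split=> [|U V FU FV|U V UV]; rewrite /F /mkset.
  - by rewrite setCT.
  - by rewrite setCI; exact: QU.
  - by apply: Qsub; exact: subsetC.
have [x [_ Fx]] : [set: T] `&` cluster F !=set0.
  by apply: cT; exact: filterT.
have [U Ux QU1] := Qloc x.
have FU : F (~` U) by rewrite /F /= setCK.
by have [z []] := Fx _ _ FU Ux.
Qed.

Lemma compact_bounded_fun (R : realType) (T : topologicalType) (f : T -> R) :
  compact [set: T] -> continuous f -> exists2 M, 0 < M & forall x, `|f x| <= M.
Proof.
move=> cT cf.
(* The bound is restated over the points of [[set: T]], so that [compact_locally] applies to the
   property of being a set on which [f] is bounded. *)
suff [M M0 fM] : exists2 M, 0 < M & forall x, [set: T] x -> `|f x| <= M.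
  by exists M => // x; exact: fM.
pattern [set: T]; apply: compact_locally => //.
- by exists 1.
- by move=> U V UV [M M0 fM]; exists M => // x /UV; exact: fM.
- move=> U V [M M0 fM] [N N0 fN]; exists (M + N); first exact: addr_gt0.
  move=> x [/fM|/fN] h; lra.
- move=> x; exists (f @^-1` (ball (f x) 1)).
    by apply: cf; exact: nbhsx_ballx.
  exists (`|f x| + 1) => [|z /=]; first exact: ltr_wpDl.
  rewrite -ball_normE /= => h.
  have := ler_normD (f x) (f z - f x); rewrite subrKC (distrC (f z)); lra.
Qed.

(** * Real Stone-Weierstrass theorem *)

Section RealStoneWeierstrass.
Variables (R : realType) (T : topologicalType) (A : set (T -> R)).
Hypothesis cT : compact [set: T].
Hypothesis A_continuous : forall f, A f -> continuous f.
Hypothesis A_const : forall c : R, A (fun=> c).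
Hypothesis A_add : forall f g, A f -> A g -> A (fun x => f x + g x).
Hypothesis A_mul : forall f g, A f -> A g -> A (fun x => f x * g x).
Hypothesis A_closed : forall f,
  (forall e, 0 < e -> exists2 g, A g & forall x, `|f x - g x| <= e) -> A f.
Hypothesis A_separates :
  forall x y, x <> y -> exists2 f, A f & f x <> f y.

Let A_scale (c : R) f : A f -> A (fun x => c * f x).
Proof. by move=> Af; apply: A_mul. Qed.

Let A_opp f : A f -> A (fun x => - f x).
Proof.
by move=> /(A_scale (-1)); under eq_fun do rewrite mulN1r.
Qed.

Let A_ext f g : f =1 g -> A f -> A g.
Proof. by move=> /funext ->. Qed.

(* Newton-like iteration converging to [`|s|] uniformly for [`|s| <= 1]. *)
Fixpoint abs_approx (k : nat) (s : R) : R :=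
  if k is k'.+1 then abs_approx k' s + (s ^+ 2 - abs_approx k' s ^+ 2) / 2
  else 0.

(** With [t] the absolute value of [s] and [p] the current approximation, one iteration multiplies
    the error [t - p] by [1 - (t + p) / 2], which is at most [1 - t / 2]. Since [(1 - t / 2) * (2 +
    (k + 1) * t) <= 2 + k * t], the bound survives. It keeps the error below [2 / k] uniformly in
    [s]. *)
Lemma abs_approx_error (k : nat) (s : R) : `|s| <= 1 ->
  [/\ 0 <= abs_approx k s, abs_approx k s <= `|s| &
      (`|s| - abs_approx k s) * (2 + k%:R * `|s|) <= 2 * `|s|].
Proof.
move=> s1; have s0 := normr_ge0 s; elim: k => [|k [p0 ps pe]] /=.
  by split => //; rewrite subr0; nra.
rewrite -(real_normK (num_real s)).
set p := abs_approx k s in p0 ps pe *; set t := `|s| in s1 s0 ps pe *.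
have k0 : 0 <= k%:R :> R by [].
have step : t - (p + (t ^+ 2 - p ^+ 2) / 2) = (t - p) * (1 - (t + p) / 2).
  by field.
have tp : 0 <= (t - p) * (t + p) by rewrite mulr_ge0 ?subr_ge0 // addr_ge0.
split; first by nra.
  by rewrite -subr_ge0 step mulr_ge0 ?subr_ge0 //; lra.
rewrite step -(natr1 k); apply: le_trans pe.
rewrite -mulrA; apply: ler_wpM2l; first by lra.
have kt0 : 0 <= k%:R * t by exact: mulr_ge0.
have kt2 : 0 <= k%:R * t * t by exact: mulr_ge0.
have ktp : 0 <= k%:R * t * p by exact: mulr_ge0.
have ptt : 0 <= t * t by exact: mulr_ge0.
have ptp : 0 <= t * p by exact: mulr_ge0.
nra.
Qed.

Lemma A_abs_approx k f : A f -> A (fun x => abs_approx k (f x)).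
Proof.
move=> Af; elim: k => [|k IH] /=; first exact: A_const.
apply: A_add => //.
apply: (A_ext _ (A_scale 2^-1 (A_add (A_mul Af Af) (A_opp (A_mul IH IH))))).
by move=> x /=; rewrite mulrC !expr2.
Qed.

Let A_abs f : A f -> A (fun x => `|f x|).
Proof.
move=> Af; have [M M0 fM] := compact_bounded_fun cT (A_continuous Af).
(* The iteration is controlled only on the unit interval, hence the rescaling by a bound [M] of
   [f]. *)
have h1 x : `|M^-1 * f x| <= 1.
  by rewrite normrM gtr0_norm ?invr_gt0 // mulrC ler_pdivrMr // mul1r.
suff /(A_scale M) : A (fun x => `|M^-1 * f x|).
  apply: A_ext => x; rewrite normrM gtr0_norm ?invr_gt0 //.
  by rewrite mulrA divff ?mul1r // gt_eqF.
apply: A_closed => e e0.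
pose k := Num.bound (2 / e).
exists (fun x => abs_approx k (M^-1 * f x)).
  by apply: A_abs_approx; exact: A_scale.
move=> x; have [p0 ps pe] := abs_approx_error k (h1 x).
set s := M^-1 * f x in p0 ps pe *; set p := abs_approx k s in p0 ps pe *.
rewrite ger0_norm ?subr_ge0 //.
have ke : 2 <= k%:R * e.
  rewrite -ler_pdivrMr //; apply/ltW/archi_boundP; apply: divr_ge0 => //.
  exact: ltW.
(* The error estimate carries a factor [|s|] on both sides, so the zero of [s] is treated apart. *)
have [->|s0] := eqVneq (`|s|) 0; first by lra.
have {}s0 : 0 < `|s| by rewrite lt_def s0 /=.
rewrite leNgt; apply/negP => ep.
suff : 2 * `|s| < (`|s| - p) * (2 + k%:R * `|s|) by lra.
have k0 : 0 <= k%:R :> R by [].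
have : k%:R * e * `|s| <= k%:R * (`|s| - p) * `|s|.
  by rewrite ler_pM2r // ler_wpM2l // ltW.
have : 2 * `|s| <= k%:R * e * `|s| by rewrite ler_pM2r.
nra.
Qed.

Let A_max f g : A f -> A g -> A (fun x => Num.max (f x) (g x)).
Proof.
move=> Af Ag.
apply: (A_ext _ (A_scale 2^-1
  (A_add (A_add Af Ag) (A_abs (A_add Af (A_opp Ag)))))) => x /=.
by have [?|?] := leP (f x) (g x); [rewrite ler0_norm|rewrite gtr0_norm]; lra.
Qed.

Let A_min f g : A f -> A g -> A (fun x => Num.min (f x) (g x)).
Proof.
move=> Af Ag; apply: (A_ext _ (A_opp (A_max (A_opp Af) (A_opp Ag)))) => x /=.
by rewrite oppr_max !opprK.
Qed.

(** An affine function of an element separating [x] and [y] takes any two prescribed values there;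
    when [x = y] a constant is enough. *)
Lemma A_interpolate (f : T -> R) x y :
  exists h, [/\ A h, h x = f x & h y = f y].
Proof.
have [<-|xy] := pselect (x = y); first by exists (fun=> f x).
have [g Ag /eqP gxy] := A_separates xy.
have g0 : g y - g x != 0 by rewrite subr_eq0 eq_sym.
exists (fun z => f x + (f y - f x) / (g y - g x) * (g z + - g x)); split.
- by apply: A_add => //; apply: A_scale; apply: A_add.
- by rewrite subrr mulr0 addr0.
- by rewrite divfK // addrC subrK.
Qed.

Let near_lt (f g : T -> R) x : continuous f -> continuous g ->
  f x < g x -> nbhs x [set z | f z < g z].
Proof.
move=> cf cg; pose h z := g z - f z.
have ch : {for x, continuous h} by apply: cvgB; [exact: cg|exact: cf].
move=> fg; have h0 : nbhs (h x) [set r : R | 0 < r].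
  by apply: lt_nbhsr; rewrite subr_gt0.
move: (ch _ h0); rewrite /nbhs /=; apply: filterS => z.
by rewrite /h /= subr_gt0.
Qed.

(** For fixed [x], a finite minimum of two-point interpolants at [x] and varying [y] stays below
    [f + e] and agrees with [f] at [x]. A finite maximum of such functions over varying [x] also
    stays above [f - e]. Both finite covers come from [compact_locally]. *)
Theorem real_stone_weierstrass (f : T -> R) : continuous f -> A f.
Proof.
move=> cf; apply: A_closed => e e0.
have [M M0 fM] := compact_bounded_fun cT cf.
have c_add c : continuous (fun z => f z + c).
  by move=> x; apply: cvgD; [exact: cf|exact: cvg_cst].
have below x : exists h, [/\ A h, h x = f x & forall z, h z < f z + e].
  suff [h [Ah hx hf]] : exists h,
      [/\ A h, h x = f x & forall z, [set: T] z -> h z < f z + e].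
    by exists h; split => // z; exact: hf.
  pattern [set: T]; apply: compact_locally => //.
  - by exists (fun=> f x).
  - by move=> U V UV [h [Ah hx hf]]; exists h; split => // z /UV; exact: hf.
  - move=> U V [h [Ah hx hf]] [k [Ak kx kf]].
    exists (fun z => Num.min (h z) (k z)); split.
    + exact: A_min.
    + by rewrite hx kx minxx.
    + by move=> z [/hf|/kf] ?; rewrite gt_min; apply/orP; [left|right].
  - move=> y; have [h [Ah hx hy]] := A_interpolate f x y.
    exists [set z | h z < f z + e]; last by exists h.
    by apply: near_lt; [exact: A_continuous|exact: c_add|rewrite hy ltrDl].
suff [h [Ah hf fh]] : exists h, [/\ A h, forall z, h z < f z + e &
    forall z, [set: T] z -> f z - e < h z].
  exists h => // x; rewrite ler_norml; have := hf x; have := fh x Logic.I; lra.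
pattern [set: T]; apply: compact_locally => //.
(* Over the empty set the upper bound by [f + e] must still hold everywhere, which a constant below
   [f] ensures. *)
- exists (fun=> - M); split => // z.
  by have := fM z; rewrite ler_norml; lra.
- move=> U V UV [h [Ah hf fh]]; exists h; split => // z /UV; exact: fh.
- move=> U V [h [Ah hf fh]] [k [Ak kf fk]].
  exists (fun z => Num.max (h z) (k z)); split.
  + exact: A_max.
  + by move=> z; rewrite gt_max hf kf.
  + by move=> z [/fh|/fk] ?; rewrite lt_max; apply/orP; [left|right].
- move=> x; have [h [Ah hx hf]] := below x.
  exists [set z | f z - e < h z]; last by exists h.
  by apply: near_lt; [exact: c_add|exact: A_continuous|rewrite hx; lra].
Qed.

End RealStoneWeierstrass.

Local Open Scope complex_scope.

Local Notation Re := complex.Re.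
Local Notation Im := complex.Im.

(** * Uniform limits, generated C*-algebras and complex Stone-Weierstrass *)

Section ComplexFunctions.
Variables (R : realType) (X : topologicalType).
Implicit Types (A : set (X -> R[i])) (f g : X -> R[i]).

Definition uniform_limit A f : Prop := forall e : R, 0 < e ->
  exists2 g, A g & forall x, `|f x - g x| <= e%:C.

(** Radii of balls are positive elements of [R[i]]; in its partial order these have zero imaginary
    part, so real radii are enough to describe the sup norm topology. *)
Lemma closed_uniformP A :
  closed (A : set {uniform X -> R[i]^o}) <->
  (forall f, uniform_limit A f -> A f).
Proof.
split=> [clA f fA|Alim f fA].
  apply: clA => B /uniform_nbhs[E [entE EB]].
  move: entE; rewrite -entourage_ballE => -[e /= e0 eE].
  (* Halving the radius turns the non-strict bound into the strict one that a ball demands. *)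
  have [g Ag fg] : exists2 g, A g & forall x, `|f x - g x| <= (Re e / 2)%:C.
    by apply: fA; rewrite divr_gt0 //; move: e0; rewrite ltcE => /andP[].
  exists g; split => //; apply: EB => x _; apply: eE.
  rewrite /= -ball_normE /=; apply: le_lt_trans (fg x) _.
  move: e0; rewrite !ltcE /= => /andP[/eqP -> e0].
  by rewrite eqxx /= ltr_pdivrMr // mulr2n mulrDr mulr1 ltrDl.
apply: Alim => e e0.
have e0' : 0 < e%:C by rewrite ltcR.
have [g [Ag fg]] : A `&` [set g | forall x, ball (f x : R[i]^o) e%:C (g x)]
    !=set0.
  apply: fA; apply/uniform_nbhs.
  exists [set xy | ball (xy.1 : R[i]^o) e%:C xy.2]; split.
    by rewrite -entourage_ballE; exists e%:C.
  by move=> g /= h x; exact: h.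
exists g => // x; apply/ltW; have := fg x.
by rewrite -ball_normE.
Qed.

Lemma continuous_Re f :
  continuous (f : X -> R[i]^o) -> continuous (fun x => Re (f x) : R).
Proof.
move=> cf x; apply/cvgrPdist_lt => e e0.
have e0' : 0 < e%:C by rewrite ltcR.
have /cvgrPdist_lt/(_ _ e0') := cf x.
apply: filterS => t ft; rewrite -ltcR; apply: le_lt_trans ft.
by have := normc_ge_Re (f x - f t); rewrite raddfB.
Qed.

Lemma continuous_realC (f : X -> R) :
  continuous f -> continuous ((fun x => (f x)%:C) : X -> R[i]^o).
Proof.
move=> cf x; apply/cvgrPdist_lt => e e0.
have /andP[/eqP Ie Re0] : (Im e == 0) && (0 < Re e) by move: e0; rewrite ltcE.
have /cvgrPdist_lt/(_ _ Re0) := cf x.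
apply: filterS => t ft.
rewrite -(RRe_real (gtr0_real e0)) -rmorphB normc_def /= expr0n /= addr0.
by rewrite sqrtr_sqr ltcR.
Qed.

Lemma continuous_conj f :
  continuous (f : X -> R[i]^o) ->
  continuous ((fun x => (f x)^*%C) : X -> R[i]^o).
Proof.
move=> cf x; apply/cvgrPdist_lt => e e0.
have /cvgrPdist_lt/(_ _ e0) := cf x.
by apply: filterS => t ft; rewrite -rmorphB normcJ.
Qed.

Lemma uniform_limit_continuous f :
  uniform_limit [set g | continuous (g : X -> R[i]^o)] f ->
  continuous (f : X -> R[i]^o).
Proof.
move=> flim x; apply/cvgrPdist_lt => e e0.
have e3 : 0 < Re e / 3.
  by rewrite divr_gt0 //; move: e0; rewrite ltcE => /andP[].
have e3' : 0 < (Re e / 3)%:C by rewrite ltcR.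
have eE : e = (Re e / 3)%:C + (Re e / 3)%:C + (Re e / 3)%:C.
  rewrite -!rmorphD -[LHS](RRe_real (gtr0_real e0)); congr (_%:C).
  by field.
have [g cg fg] := flim _ e3.
have /cvgrPdist_lt/(_ _ e3') := cg x.
apply: filterS => t gt.
have -> : f x - f t = (f x - g x) + (g x - g t) + (g t - f t) by ring.
rewrite eE; apply: le_lt_trans (ler_normD _ _) _.
rewrite ltr_leD //; last by rewrite distrC.
by apply: le_lt_trans (ler_normD _ _) _; rewrite ler_ltD.
Qed.

Lemma continuous_cstar :
  cstar_subalgebra [set f | continuous (f : X -> R[i]^o)].
Proof.
split => //=.
- by move=> x; exact: cvg_cst.
- by move=> f g cf cg x; apply: cvgD; [exact: cf|exact: cg].
- by move=> c f cf x; apply: cvgM; [exact: cvg_cst|exact: cf].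
- by move=> f g cf cg x; apply: cvgM; [exact: cf|exact: cg].
- exact: continuous_conj.
- by apply/closed_uniformP => f; exact: uniform_limit_continuous.
Qed.

Lemma sub_cstar_gen (S : set (X -> R[i])) : S `<=` cstar_gen S.
Proof. exact: sub_smallest. Qed.

Lemma cstar_gen_sub (S A : set (X -> R[i])) :
  cstar_subalgebra A -> S `<=` A -> cstar_gen S `<=` A.
Proof. exact: smallest_sub. Qed.

(** The algebraic clauses and closedness pass to intersections. Continuity holds because the
    hypothesis makes the algebra of all continuous functions one of the intersected algebras. *)
Lemma cstar_gen_cstar (S : set (X -> R[i])) :
  (forall f, S f -> continuous (f : X -> R[i]^o)) ->
  cstar_subalgebra (cstar_gen S).
Proof.
move=> Sc; split.
- by apply: cstar_gen_sub => //; exact: continuous_cstar.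
- by move=> B [/cstar_one].
- by move=> f g Sf Sg B SB; apply: (cstar_add SB.1); [exact: Sf|exact: Sg].
- by move=> c f Sf B SB; apply: (cstar_scale SB.1); exact: Sf.
- by move=> f g Sf Sg B SB; apply: (cstar_mul SB.1); [exact: Sf|exact: Sg].
- by move=> f Sf B SB; apply: (cstar_star SB.1); exact: Sf.
- apply/closed_uniformP => f flim B SB.
  apply: (closed_uniformP B).1 (cstar_closed SB.1) _ _ => e /flim[g Sg fg].
  by exists g => //; exact: Sg.
Qed.

(** The real functions lying in [A] form a closed separating real algebra, hence contain all
    continuous real functions; [A] then contains real and imaginary parts. *)
Theorem stone_weierstrass A : compact [set: X] -> cstar_subalgebra A ->
  (forall x y, x <> y ->
     exists2 u : X -> R, A (fun z => (u z)%:C) & u x <> u y) ->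
  A = [set f | continuous (f : X -> R[i]^o)].
Proof.
move=> cX cA Asep; apply/seteqP; split => [f Af|f cf].
  exact: (cstar_continuous cA Af).
have real_part (u : X -> R) : continuous u -> A (fun z => (u z)%:C).
  move: u; apply: (@real_stone_weierstrass _ _
    [set u : X -> R | A (fun z => (u z)%:C)]) => //=.
  - by move=> u /(cstar_continuous cA)/continuous_Re.
  - move=> c; have := cstar_scale cA c%:C (cstar_one cA).
    by under eq_fun do rewrite mulr1.
  - move=> u v Au Av; under eq_fun do rewrite rmorphD.
    exact: (cstar_add cA).
  - move=> u v Au Av; under eq_fun do rewrite rmorphM.
    exact: (cstar_mul cA).
  - move=> u ulim; apply: (closed_uniformP A).1; first exact: cstar_closed cA.
    move=> e /ulim[v Av uv]; exists (fun z => (v z)%:C) => // x.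
    by rewrite -rmorphB normc_def /= expr0n /= addr0 sqrtr_sqr lecR.
(* The imaginary part is written as the real part of [- 'i * f], so that [continuous_Re] covers both
   parts. *)
have -> : f = (fun x => (Re (f x))%:C + 'i * (Re (- 'i * f x))%:C).
  apply/funext => x; rewrite {1}[f x]complexE.
  congr (_ + 'i * _%:C).
  by rewrite mulrC mulrN -mulNr ReiNIm raddfN opprK.
have Re_part := real_part _ (continuous_Re cf).
have Im_part := real_part _
  (continuous_Re (cstar_scale continuous_cstar (- 'i) cf)).
exact: (cstar_add cA Re_part (cstar_scale cA 'i Im_part)).
Qed.

End ComplexFunctions.

Section CstarAlgebraOps.
Variables (R : realType) (X : topologicalType) (A : set (X -> R[i])).
Hypothesis cA : cstar_subalgebra A.

Lemma cstar_sum (I : finType) (F : I -> X -> R[i]) :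
  (forall i, A (F i)) -> A (fun x => \sum_i F i x).
Proof.
move=> AF; elim: (index_enum I) => [|i r IH].
  rewrite [X in A X](_ : _ = (fun=> 0 * 1)).
    exact: (cstar_scale cA 0 (cstar_one cA)).
  by apply/funext => x; rewrite big_nil mul0r.
rewrite [X in A X](_ : _ = (fun x => F i x + \sum_(k <- r) F k x)).
  exact: (cstar_add cA (AF i) IH).
by apply/funext => x; rewrite big_cons.
Qed.

End CstarAlgebraOps.

(** * Compactness and coordinate functions of the orthogonal group *)

Section OrthogonalGroup.
Variables (R : realType) (n : nat).
Local Notation O := (orth_group R n).

(** A filter on the subtype is pushed forward to [T]. A cluster point of the image in [A] lifts
    back, since open sets of the subtype are preimages of open sets. *)
Lemma compact_setT_subtype (T : topologicalType) (A : set T) :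
  compact A -> compact [set: A].
Proof.
move=> cA F PF _.
have FA : F (set_val @^-1` A).
  rewrite (_ : _ @^-1` _ = setT); first exact: filterT.
  by apply/seteqP; split => // x _; exact: (set_valP x).
have [p [Ap Fp]] := cA _ (fmap_proper_filter set_val PF) FA.
exists (exist _ p (mem_set Ap)); split => // U V FU.
move=> [_ [[W oW <-] /= pW WV]].
have FU' : F (set_val @^-1` (set_val @` U)).
  by apply: (filterS (P := U)) FU => x Ux; exists x.
have [_ [[x Ux <-] Wx]] := Fp _ _ FU' (open_nbhs_nbhs (conj oW pW)).
by exists x; split => //; exact: WV.
Qed.

(** Carries compactness of a cube of row vectors over to matrices. *)
Lemma continuous_vec_mx (p q : nat) :
  continuous (@vec_mx R p q : 'rV[R]_(p * q) -> 'M[R]_(p, q)).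
Proof.
move=> v U [P Pv PU].
have Pw (ij : 'I_p * 'I_q) : nbhs v [set w : 'rV[R]_(p * q) |
    P ij.1 ij.2 (w ord0 (mxvec_index ij.1 ij.2))].
  by apply: coord_continuous; have := Pv ij.1 ij.2; rewrite mxE.
apply: filterS (filter_forall _ Pw) => w wP.
by apply: PU => i j; rewrite mxE; exact: (wP (i, j)).
Qed.

Lemma closed_orth_group : closed O.
Proof.
have -> : O = \bigcap_(ij in [set: 'I_n * 'I_n])
    [set x : 'M[R]_n | \sum_k x ij.1 k * x ij.2 k = (ij.1 == ij.2)%:R].
  apply/seteqP; split => x /=.
    move=> xx [i j] _ /=; have /matrixP/(_ i j) := xx.
    by rewrite !mxE => <-; apply: eq_bigr => k _; rewrite mxE.
  move=> xx; apply/matrixP => i j; have /= := xx (i, j) Logic.I.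
  by rewrite !mxE => <-; apply: eq_bigr => k _; rewrite mxE.
apply: closed_bigI => -[i j] _ /=.
have cs : continuous (fun x : 'M[R]_n => \sum_k x i k * x j k : R).
  apply: (@continuous_big R 'I_n +%R 0 xpredT (@add_continuous R)) => k _ y.
  have cc a b : continuous (fun x : 'M[R]_n => x a b).
    by move=> ?; exact: coord_continuous.
  by apply: (@cvgM _ _ (nbhs y)); exact: cc.
exact: (preimage_closed (fun x _ => cs x) (@closed_eq R (i == j)%:R)).
Qed.

(** Rows of norm 1 have entries in [[-1, 1]], so the group is a closed subset of the continuous
    image of a compact cube. *)
Lemma compact_orth_group : compact O.
Proof.
pose B := [set v : 'rV[R]_(n * n) |
  forall k, `[(-1 : R), 1]%classic (v ord0 k)].
have cB : compact B.
  apply: (@rV_compact R _ (fun=> `[(-1 : R), 1]%classic)) => _.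
  exact: segment_compact.
apply: (subclosed_compact closed_orth_group
  (continuous_compact (continuous_subspaceT (@continuous_vec_mx n n)) cB)).
move=> x /= xx; exists (mxvec x); last by rewrite mxvecK.
move=> k; case/mxvec_indexP: k => i j; rewrite /= mxvecE in_itv /= -ler_norml.
have /matrixP/(_ i i) := xx; rewrite !mxE eqxx => /= xi.
rewrite -(expr_le1 (n := 2)) // real_normK ?num_real //.
rewrite -[leRHS]xi.
rewrite (bigD1 j) //= mxE -expr2 lerDl; apply: sumr_ge0 => l _.
by rewrite mxE -expr2 sqr_ge0.
Qed.

Lemma continuous_entry (i j : 'I_n) :
  continuous (fun x : O => set_val x i j : R).
Proof.
move=> x; apply: (@continuous_comp _ _ _ (set_val : O -> 'M[R]_n)
  (fun M : 'M[R]_n => M i j)); first exact: initial_continuous.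
exact: coord_continuous.
Qed.

Lemma continuous_ocoord (i j : 'I_n) :
  continuous (ocoord i j : O -> R[i]^o).
Proof. exact: (continuous_realC (@continuous_entry i j)). Qed.

(** The coordinates are real-valued, and two matrices with equal entries coincide, so
    Stone-Weierstrass applies. *)
Lemma cstar_gen_ocoord :
  cstar_gen (entries (@ocoord R n)) = [set f | continuous (f : O -> R[i]^o)].
Proof.
apply: stone_weierstrass.
- exact: compact_setT_subtype compact_orth_group.
- by apply: cstar_gen_cstar => _ [i [j ->]]; exact: continuous_ocoord.
- move=> x y xy.
  have [i [j xyij]] : exists i j, set_val x i j <> set_val y i j.
    apply: contrapT => H; apply: xy; apply: val_inj; apply/matrixP => i j.
    by apply: contrapT => ?; apply: H; exists i, j.
  exists (fun z : O => set_val z i j) => //.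
  by apply: sub_cstar_gen; exists i, j.
Qed.

Lemma orth_row_norm (x : O) (i : 'I_n) :
  \sum_j ocoord i j x * ocoord i j x = 1.
Proof.
have /matrixP/(_ i i) := set_valP x; rewrite !mxE eqxx mulr1n => xi.
rewrite -[RHS](rmorph1 (@real_complex R)) -[1 in RHS]xi rmorph_sum.
by apply: eq_bigr => j _; rewrite mxE rmorphM.
Qed.

Lemma ocoord_omul (x y : O) (i j : 'I_n) :
  ocoord i j (omul x y) = \sum_k ocoord i k x * ocoord k j y.
Proof.
by rewrite /ocoord mxE rmorph_sum; apply: eq_bigr => k _; rewrite rmorphM.
Qed.

Lemma conj_ocoord (x : O) (i j : 'I_n) : (ocoord i j x)^*%C = ocoord i j x.
Proof. exact: conjc_real. Qed.

End OrthogonalGroup.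

(** * Comultiplication on generated subalgebras *)

Section WordAlgebras.
Variables (R : realType) (n : nat).
Local Notation O := (orth_group R n).
Implicit Types (A : set (O -> R[i])) (s : seq ('I_n * 'I_n)).

Lemma continuous_tensor (X Y : topologicalType)
    (f : X -> R[i]) (g : Y -> R[i]) :
  continuous (f : X -> R[i]^o) -> continuous (g : Y -> R[i]^o) ->
  continuous (tensor f g : X * Y -> R[i]^o).
Proof.
move=> cf cg x; apply: (@cvgM _ _ (nbhs x)).
  by apply: (cvg_comp _ _ cvg_fst); exact: cf.
by apply: (cvg_comp _ _ cvg_snd); exact: cg.
Qed.

Lemma tensor_alg_cstar (X Y : topologicalType) (A : set (X -> R[i]))
    (B : set (Y -> R[i])) :
  cstar_subalgebra A -> cstar_subalgebra B -> cstar_subalgebra (tensor_alg A B).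
Proof.
move=> cA cB; apply: cstar_gen_cstar => _ [f Af [g Bg ->]].
by apply: continuous_tensor;
  [exact: cstar_continuous Af|exact: cstar_continuous Bg].
Qed.

(** The functions whose comultiplication lies in the tensor product form a C*-algebra, and the
    matrix rule [vM] puts the generators into it. *)
Lemma odelta_cstar_gen (I : finType) (v : I -> I -> O -> R[i]) :
  (forall i j, continuous (v i j : O -> R[i]^o)) ->
  (forall i j x y, v i j (omul x y) = \sum_k v i k x * v k j y) ->
  let A := cstar_gen (entries v) in
  forall f, A f -> tensor_alg A A (odelta f).
Proof.
move=> cv vM A.
have cA : cstar_subalgebra A.
  by apply: cstar_gen_cstar => _ [i [j ->]]; exact: cv.
have cT := tensor_alg_cstar cA cA.
(* Membership in [A] is kept in the set because it supplies continuity of [f]. *)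
suff : A `<=` [set f | A f /\ tensor_alg A A (odelta f)] by move=> h f /h[].
apply: cstar_gen_sub.
  split => /=.
  - by move=> f [/(cstar_continuous cA)].
  - by split; [exact: (cstar_one cA)|exact: (cstar_one cT)].
  - move=> f g [Af Tf] [Ag Tg].
    by split; [exact: (cstar_add cA Af Ag)|exact: (cstar_add cT Tf Tg)].
  - move=> c f [Af Tf].
    by split; [exact: (cstar_scale cA c Af)|exact: (cstar_scale cT c Tf)].
  - move=> f g [Af Tf] [Ag Tg].
    by split; [exact: (cstar_mul cA Af Ag)|exact: (cstar_mul cT Tf Tg)].
  - move=> f [Af Tf].
    by split; [exact: (cstar_star cA Af)|exact: (cstar_star cT Tf)].
  - apply/closed_uniformP => f flim; split.
      apply: (closed_uniformP A).1 (cstar_closed cA) _ _ => e.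
      by move=> /flim[g [Ag _] fg]; exists g.
    apply: (closed_uniformP _).1 (cstar_closed cT) _ _ => e /flim[g [_ Tg] fg].
    (* Values of [odelta f] are values of [f], so comultiplication does not increase sup
       distances. *)
    by exists (odelta g) => // p; exact: fg.
move=> _ [i [j ->]]; split; first by apply: sub_cstar_gen; exists i, j.
have -> : odelta (v i j) = (fun p => \sum_k tensor (v i k) (v k j) p).
  by apply/funext => p; exact: vM.
apply: (cstar_sum cT) => k; apply: sub_cstar_gen.
by exists (v i k); [|exists (v k j) => //];
  apply: sub_cstar_gen; [exists i, k|exists k, j].
Qed.

(** Isomorphism as compact quantum groups ignores the fundamental matrix: with a common algebra and
    comultiplication, the identity serves for both maps. *)
Lemma cqg_isomorphic_refl A (I J : finType) (v : I -> I -> O -> R[i])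
    (w : J -> J -> O -> R[i]) :
  (forall f, A f -> tensor_alg A A (odelta f)) ->
  cqg_isomorphic (@Cmqg R O A (@odelta R n) I v)
                 (@Cmqg R O A (@odelta R n) J w).
Proof.
move=> dA; split => //; exists id, id; split => //.
split; first by split.
by split => // f Af; exists f.
Qed.

(** * Algebras generated by monomials of fixed degree *)

Definition monomial s (x : O) : R[i] := \prod_(p <- s) ocoord p.1 p.2 x.

Definition monomials (d : nat) : set (O -> R[i]) :=
  [set f | exists2 s, size s = d & f = monomial s].

Lemma monomial_cons p s x :
  monomial (p :: s) x = ocoord p.1 p.2 x * monomial s x.
Proof. exact: big_cons. Qed.

Lemma monomial_cat s t x : monomial (s ++ t) x = monomial s x * monomial t x.
Proof. exact: big_cat. Qed.

Lemma continuous_monomial s : continuous (monomial s : O -> R[i]^o).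
Proof.
elim: s => [|p s IH].
  rewrite (_ : monomial [::] = (fun=> 1)); last first.
    by apply/funext => x; exact: big_nil.
  exact: (cstar_one (continuous_cstar _ _)).
rewrite (_ : monomial (p :: s) = (fun x => ocoord p.1 p.2 x * monomial s x)).
  exact: (cstar_mul (continuous_cstar _ _) (@continuous_ocoord R n _ _) IH).
by apply/funext => x; exact: monomial_cons.
Qed.

Lemma monomials_cstar d : cstar_subalgebra (cstar_gen (monomials d)).
Proof. by apply: cstar_gen_cstar => _ [s _ ->]; exact: continuous_monomial. Qed.

Lemma monomials_add A d e : cstar_subalgebra A ->
  monomials d `<=` A -> monomials e `<=` A -> monomials (d + e) `<=` A.
Proof.
move=> cA dA eA _ [s sde ->].
have -> : monomial s = (fun x => monomial (take d s) x * monomial (drop d s) x).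
  by apply/funext => x; rewrite -monomial_cat cat_take_drop.
apply: (cstar_mul cA).
  by apply: dA; exists (take d s) => //; rewrite size_takel // sde leq_addr.
by apply: eA; exists (drop d s) => //; rewrite size_drop sde addKn.
Qed.

(* The relation [\sum_k u_{ak} u_{ak} = 1], with [a] a row index already
   occurring in the monomial. *)
Lemma monomials_reduce d : (0 < d)%N ->
  monomials d `<=` cstar_gen (monomials d.+2).
Proof.
move=> d0 _ [[|p s] sd ->]; first by rewrite -sd in d0.
have -> : monomial (p :: s) =
    (fun x => \sum_k monomial [:: (p.1, k), (p.1, k), p & s] x).
  apply/funext => x; rewrite -[LHS]mul1r -(orth_row_norm x p.1) mulr_suml.
  by apply: eq_bigr => k _; rewrite -mulrA !(monomial_cons (p.1, k)).
apply: (cstar_sum (monomials_cstar _)) => k; apply: sub_cstar_gen.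
by exists [:: (p.1, k), (p.1, k), p & s] => //=; rewrite -sd.
Qed.

(** Degree [r + 2h] arises from degree [r] by multiplying with [h] monomials of degree 2, already in
    the algebra. Conversely, [monomials_reduce] is iterated [h] times, starting from the positive
    degree [r]. *)
Lemma cstar_gen_monomials r h : r = 1 \/ r = 2 ->
  cstar_gen (monomials (r + h.*2)) = cstar_gen (monomials r).
Proof.
move=> r12; have r0 : (0 < r)%N by case: r12 => ->.
apply/seteqP; split; apply: cstar_gen_sub; try exact: monomials_cstar.
  have m2 : monomials 2 `<=` cstar_gen (monomials r).
    case: r12 => ->; last exact: sub_cstar_gen.
    by apply: (@monomials_add _ 1 1); [exact: monomials_cstar|
      exact: sub_cstar_gen|exact: sub_cstar_gen].
  elim: h => [|h IH]; first by rewrite addn0; exact: sub_cstar_gen.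
  rewrite doubleS -addn2 addnA.
  by apply: monomials_add => //; exact: monomials_cstar.
elim: h => [|h IH]; first by rewrite addn0; exact: sub_cstar_gen.
apply: (subset_trans IH); apply: cstar_gen_sub; first exact: monomials_cstar.
by rewrite doubleS 2!addnS; apply: monomials_reduce; rewrite addn_gt0 r0.
Qed.

(** * Matrix entries as monomials *)

Lemma entries_word_coord m :
  entries (@word_coord R n (nseq m white)) = monomials m.
Proof.
set z := nseq m white; have sz : size z = m by rewrite size_nseq.
have wz k : tnth (in_tuple z) k = white.
  by rewrite (tnth_nth white) nth_nseq; case: ifP.
apply/seteqP; split => f.
- move=> [i [j ->]].
  (* A row multi-index and a column multi-index are zipped into one list of index pairs; the
     converse inclusion unzips it. *)
  exists [tuple (tnth i k, tnth j k) | k < size z]; first by rewrite size_tuple.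
  apply/funext => x; rewrite /monomial big_tuple /word_coord.
  by apply: eq_bigr => k _; rewrite wz tnth_mktuple.
- move=> [s sm ->].
  have ssz : size s == size z by rewrite sz sm.
  exists (map_tuple fst (Tuple ssz)), (map_tuple snd (Tuple ssz)).
  apply/funext => x; rewrite /word_coord.
  rewrite -[s in LHS]/(tval (Tuple ssz)) /monomial big_tuple.
  by apply: eq_bigr => k _; rewrite wz !tnth_map.
Qed.

Lemma entries_ocoord : entries (@ocoord R n) = monomials 1.
Proof.
have mE p : monomial [:: p] = ocoord p.1 p.2.
  by apply/funext => x; rewrite /monomial big_seq1.
apply/seteqP; split => [_ [i [j ->]]|_ [[|p [|q s]] // _ ->]].
  by exists [:: (i, j)] => //; rewrite mE.
by exists p.1, p.2; rewrite mE.
Qed.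

(** Conjugation is trivial on the real coordinates; what remains is to regroup two (row, column)
    pairs into a pair of rows and a pair of columns. *)
Lemma entries_proj_coord : entries (@proj_coord R n) = monomials 2.
Proof.
have mE p q : monomial [:: p; q] = proj_coord (p.1, q.1) (p.2, q.2).
  apply/funext => x.
  by rewrite /monomial big_cons big_seq1 /proj_coord conj_ocoord.
apply/seteqP; split => [_ [i [j ->]]|_ [[|p [|q [|t s]]] // _ ->]].
  by exists [:: (i.1, j.1); (i.2, j.2)] => //; rewrite mE; case: i; case: j.
by exists (p.1, q.1), (p.2, q.2); rewrite mE.
Qed.

Lemma continuous_proj_coord i j : continuous (proj_coord i j : O -> R[i]^o).
Proof.
have [s _ ->] : monomials 2 (proj_coord i j).
  by rewrite -entries_proj_coord; exists i, j.
exact: continuous_monomial.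
Qed.

Lemma proj_coord_omul (i j : 'I_n * 'I_n) (x y : O) :
  proj_coord i j (omul x y) = \sum_k proj_coord i k x * proj_coord k j y.
Proof.
have projE a b z : proj_coord a b z = ocoord a.1 b.1 z * ocoord a.2 b.2 z.
  by rewrite /proj_coord conj_ocoord.
rewrite projE !ocoord_omul mulr_suml.
under eq_bigr do rewrite mulr_sumr.
by rewrite pair_bigA; apply: eq_bigr => k _; rewrite !projE mulrACA.
Qed.

End WordAlgebras.

Theorem proposition5p11 (R : realType) (n m : nat) (hm : (1 <= m)%N) :
  (odd m -> cqg_isomorphic (O_word_cmqg R n (nseq m white)) (O_cmqg R n)) /\
  (~~ odd m -> cqg_isomorphic (O_word_cmqg R n (nseq m white)) (PO_cmqg R n)).
Proof.
split => om.
  rewrite /O_word_cmqg /O_cmqg entries_word_coord.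
  have -> : m = (1 + (m./2).*2)%N by rewrite -[LHS]odd_double_half om.
  rewrite cstar_gen_monomials; last by left.
  (* All continuous functions are replaced by the algebra generated by degree 1, so both sides have
     the same algebra. *)
  rewrite -cstar_gen_ocoord -entries_ocoord.
  apply: cqg_isomorphic_refl; apply: odelta_cstar_gen.
    exact: continuous_ocoord.
  by move=> i j x y; exact: ocoord_omul.
rewrite /O_word_cmqg /PO_cmqg entries_word_coord.
(* An even [m >= 1] is at least 2, so the predecessor of [m./2] is not truncated. *)
have -> : m = (2 + (m./2.-1).*2)%N.
  rewrite -{1}(odd_double_half m) (negbTE om) add0n.
  by case: m hm om => [|[|m]].
rewrite cstar_gen_monomials; last by right.
rewrite -entries_proj_coord.
apply: cqg_isomorphic_refl; apply: odelta_cstar_gen.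
  exact: continuous_proj_coord.
exact: proj_coord_omul.
Qed.
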